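(* For every integer $k\ge 2$, the $k$-partition mechanism is $\frac{k-1}{2k}$-optimal. That is, for every finite directed graph $G=(N,E)$ without loops with maximum indegree $\Delta(G)>0$, the vertex $i$ selected from $G$ by the $k$-partition mechanism satisfies $\mathbb{E}[\delta^-(i,G)]\ge \frac{k-1}{2k}\,\Delta(G)$.
   Context: Graphs are finite directed graphs $G=(N,E)$ with vertex set $N=\{1,\dots,n\}$, $n\ge 1$, and $E\subseteq\{(i,j)\in N\times N: i\ne j\}$. For $S\subseteq N$ and $i\in N$, $\delta^-_S(i)=|\{j\in S:(j,i)\in E\}|$ is the indegree of $i$ from $S$; $\delta^-(i,G)=\delta^-(i)=\delta^-_N(i)$; and $\Delta(G)=\max_{i\in N}\delta^-(i,G)$. A selection mechanism maps each graph to a probability distribution on its vertices (the selected vertex is drawn from this distribution). It is $\alpha$-optimal if for every graph $G$ with $\Delta(G)>0$ the expected indegree of the selected vertex is at least $\alpha\,\Delta(G)$. $k$-partition mechanism (for fixed $k\ge2$). On input $G=(N,E)$: assign each $i\in N$ independently and uniformly at random to one of $k$ sets $A_1,\dots,A_k$, and write $A_{<j}=\bigcup_{i=1}^{j-1}A_i$. Choose a candidate $c\in A_1$ arbitrarily and set $d:=0$ (if $A_1=\emptyset$ there is initially no candidate, and $\{c\}$ is read as $\emptyset$). For $j=2,\dots,k$ in this order: if $A_j\neq\emptyset$ and $\max_{i\in A_j}\delta^-_{A_{<j}\setminus\{c\}}(i)\ge d$, then choose a new candidate $c$ uniformly at random from $\arg\max_{i\in A_j}\delta^-_{A_{<j}}(i)$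 and set $d:=\delta^-_{A_{<j}}(c)$ (otherwise leave $c,d$ unchanged). Return $c$. *)

(* Defs.v *)
From mathcomp Require Import all_boot all_order all_algebra.
Import Order.TTheory GRing.Theory Num.Theory.

Set Implicit Arguments.
Unset Strict Implicit.
Unset Printing Implicit Defensive.

Local Open Scope ring_scope.

Record digraph (n : nat) := Digraph {
  arcs : {set 'I_n * 'I_n};
  no_loops : forall i, (i, i) \notin arcs
}.

Definition indeg n (G : digraph n) (S : {set 'I_n}) (i : 'I_n) : nat :=
  #|[set j in S | (j, i) \in arcs G]|.

Definition max_indeg n (G : digraph n) : nat :=
  \max_(i < n) indeg G [set: 'I_n] i.

Record fdist (R : realFieldType) (T : finType) := FDist {
  prob :> T -> R;
  prob_ge0 : forall x, 0 <= prob x;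
  prob_sum1 : \sum_x prob x = 1
}.

(* Graphs have at least one vertex, hence the shape n.+1. *)
Definition selection_mechanism (R : realFieldType) :=
  forall n, digraph n.+1 -> fdist R 'I_n.+1.

Definition optimal (R : realFieldType) (alpha : R)
    (M : selection_mechanism R) : Prop :=
  forall n (G : digraph n.+1), (0 < max_indeg G)%N ->
    alpha * (max_indeg G)%:R <= \sum_i M n G i * (indeg G setT i)%:R.

(* The sets A_1, ..., A_k are encoded by a : {ffun 'I_n -> 'I_k} and indexed
   from 0: [block a j] is A_(j+1), and [before a j] is A_1 U ... U A_j, the
   union of the sets preceding it. *)
Definition block n k (a : {ffun 'I_n -> 'I_k}) (j : nat) : {set 'I_n} :=
  [set i | a i == j :> nat].

Definition before n k (a : {ffun 'I_n -> 'I_k}) (j : nat) : {set 'I_n} :=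
  [set i | (a i < j)%N].

Definition candidate_set n (c : option 'I_n) : {set 'I_n} :=
  if c is Some v then [set v] else set0.

Definition argmax_set (T : finType) (A : {set T}) (f : T -> nat) : {set T} :=
  [set i in A | [forall i' in A, (f i' <= f i)%N]].

(* An arbitrary way of choosing the initial candidate in A_1, possibly
   randomized and depending on the graph and on the partition. When A_1 is
   empty its value is unconstrained, and unused. *)
Record initial_choice (R : realFieldType) (k : nat) := InitialChoice {
  initial :> forall n, digraph n.+1 -> {ffun 'I_n.+1 -> 'I_k} ->
    fdist R 'I_n.+1;
  initial_supp : forall n (G : digraph n.+1) (a : {ffun 'I_n.+1 -> 'I_k}),
    block a 0 != set0 -> forall i, initial G a i != 0 -> i \in block a 0
}.

(* Probability that i is returned when the iterations whose (0-based) indices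
   are listed in js remain to be run from the state (c, d), given the
   partition a. *)
Fixpoint run (R : realFieldType) n k (G : digraph n) (a : {ffun 'I_n -> 'I_k})
    (js : seq nat) (c : option 'I_n) (d : nat) (i : 'I_n) : R :=
  if js is j :: js' then
    if (block a j != set0) &&
       (d <= \max_(v in block a j)
               indeg G (before a j :\: candidate_set c) v)%N
    then
      let A := argmax_set (block a j) (indeg G (before a j)) in
      \sum_(c' in A)
        #|A|%:R^-1 * run R G a js' (Some c') (indeg G (before a j) c') i
    else run R G a js' c d i
  else (c == Some i)%:R.

Definition kpart_given (R : realFieldType) k (init : initial_choice R k) n
    (G : digraph n.+1) (a : {ffun 'I_n.+1 -> 'I_k}) (i : 'I_n.+1) : R :=
  if block a 0 == set0 then run R G a (iota 1 k.-1) None 0 i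
  else \sum_c init n G a c * run R G a (iota 1 k.-1) (Some c) 0 i.

(* The partition a has probability \prod_v 1/k, by independence. *)
Definition kpart_prob (R : realFieldType) k (init : initial_choice R k) n
    (G : digraph n.+1) (i : 'I_n.+1) : R :=
  \sum_(a : {ffun 'I_n.+1 -> 'I_k})
    (\prod_(v < n.+1) k%:R^-1) * kpart_given init G a i.

Section KPartIsDistribution.
Variable R : realFieldType.

Lemma run_ge0 n k (G : digraph n) (a : {ffun 'I_n -> 'I_k}) js c d i :
  0 <= run R G a js c d i.
Proof.
elim: js c d => [|j js IH] c d /=; first exact: ler0n.
case: ifP => _; last exact: IH.
by apply: sumr_ge0 => c' _; rewrite mulr_ge0 // invr_ge0 ler0n.
Qed.

Lemma argmax_set_gt0 (T : finType) (A : {set T}) (f : T -> nat) :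
  A != set0 -> (0 < #|argmax_set A f|)%N.
Proof.
case/set0Pn=> x xA; rewrite card_gt0; apply/set0Pn.
case: (@arg_maxnP _ x (fun y => y \in A) f xA) => y yA ymax; exists y.
by rewrite inE yA; apply/forall_inP => z; apply: ymax.
Qed.

Lemma run_sum1 n k (G : digraph n) (a : {ffun 'I_n -> 'I_k}) js c d :
  (c != None) || (d == 0%N) && has (fun j => block a j != set0) js ->
  \sum_i run R G a js c d i = 1.
Proof.
elim: js c d => [|j js IH] c d /=.
  case: c => [c|]; last by rewrite andbF.
  move=> _; rewrite (bigD1 c) //= eqxx big1 ?addr0 // => i ic.
  by rewrite (_ : (Some c == Some i) = (c == i)) // eq_sym (negbTE ic).
move=> ok; case cond: ((block a j != set0) && _).
  case/andP: cond => ne _.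
  rewrite exchange_big /=.
  under eq_bigr do rewrite -mulr_sumr IH // mulr1.
  rewrite sumr_const -[_ *+ _]mulr_natl mulfV // pnatr_eq0 -lt0n.
  exact: argmax_set_gt0.
apply: IH; move: ok cond; case: c => //= /andP[/eqP-> ].
by case: (block a j != set0).
Qed.

Lemma kpart_given_ge0 k (init : initial_choice R k) n (G : digraph n.+1)
  (a : {ffun 'I_n.+1 -> 'I_k}) i : 0 <= kpart_given init G a i.
Proof.
rewrite /kpart_given; case: ifP => _; first exact: run_ge0.
by apply: sumr_ge0 => c _; rewrite mulr_ge0 ?prob_ge0 ?run_ge0.
Qed.

Lemma kpart_given_sum1 k (init : initial_choice R k) n (G : digraph n.+1)
  (a : {ffun 'I_n.+1 -> 'I_k}) : \sum_i kpart_given init G a i = 1.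
Proof.
rewrite /kpart_given; case A0: (block a 0 == set0).
  apply: run_sum1 => /=; apply/hasP; exists (nat_of_ord (a ord0)); last first.
    by apply/set0Pn; exists ord0; rewrite inE.
  have lt_ak := ltn_ord (a ord0).
  have kE : (1 + k.-1 = k)%N by rewrite add1n prednK // (leq_ltn_trans _ lt_ak).
  rewrite mem_iota kE lt_ak andbT lt0n.
  by apply/negP => a0; move/eqP/setP/(_ ord0): A0; rewrite !inE a0.
rewrite exchange_big /= -(prob_sum1 (init n G a)).
by apply: eq_bigr => c _; rewrite -mulr_sumr run_sum1 ?mulr1.
Qed.

Lemma kpart_prob_ge0 k (init : initial_choice R k) n (G : digraph n.+1) i :
  0 <= kpart_prob init G i.
Proof.
apply: sumr_ge0 => a _; rewrite mulr_ge0 ?kpart_given_ge0 //.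
by apply: prodr_ge0 => v _; rewrite invr_ge0 ler0n.
Qed.

Lemma kpart_prob_sum1 k (hk : (2 <= k)%N) (init : initial_choice R k) n
  (G : digraph n.+1) : \sum_i kpart_prob init G i = 1.
Proof.
rewrite exchange_big /=.
under eq_bigr => a _ do rewrite -mulr_sumr kpart_given_sum1 mulr1.
rewrite -(bigA_distr_bigA (fun (_ : 'I_n.+1) (_ : 'I_k) => k%:R^-1 : R)).
rewrite big1 // => v _; rewrite sumr_const card_ord -[_ *+ _]mulr_natl mulfV //.
by rewrite pnatr_eq0 -lt0n (ltn_trans _ hk).
Qed.

End KPartIsDistribution.

Definition kpartition (R : realFieldType) k (hk : (2 <= k)%N)
    (init : initial_choice R k) : selection_mechanism R :=
  fun n G => FDist (kpart_prob_ge0 init G) (kpart_prob_sum1 hk init G).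

(* Main.v *)
Require Import Defs.
From mathcomp Require Import all_boot all_order all_algebra.
From mathcomp Require Import ring.
Import Order.TTheory GRing.Theory Num.Theory.
Local Open Scope ring_scope.

(** Fix a vertex [i0] of maximum indegree. Whenever the block of [i0] is
    processed, the new value of [d] is at least the indegree of [i0] from the
    earlier blocks: if the candidate [c] is not replaced, then discarding [c]
    costs [i0] at most one incoming arc, which the strict inequality in the
    failed test makes up for. As [d] never decreases and is
    always at most the indegree of the current candidate, the selected vertex
    has indegree at least that of [i0] from the earlier blocks. An in-neighbour
    of [i0] lies in an earlier block with probability (k - 1) / (2k). *)

Lemma leq_indeg {n} (G : digraph n) {S T : {set 'I_n}} i :
  S \subset T -> (indeg G S i <= indeg G T i)%N.
Proof.
move=> /subsetP sST; apply/subset_leq_card/subsetP => j.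
by rewrite !inE => /andP[/sST-> ->].
Qed.

Lemma indeg_set0 n (G : digraph n) i : indeg G set0 i = 0%N.
Proof. by apply: eq_card0 => j; rewrite !inE. Qed.

Lemma indeg_del_candidate {n} (G : digraph n) (S : {set 'I_n}) c i :
  (indeg G S i <= (indeg G (S :\: candidate_set c) i).+1)%N.
Proof.
case: c => [c|] /=; last by rewrite setD0.
rewrite /indeg; set B := [set j in _ | _] => /=.
rewrite (cardsD1 c B) -add1n leq_add ?leq_b1 //.
by apply/subset_leq_card/subsetP => j; rewrite !inE andbA.
Qed.

(** The disjunction is the loop invariant: either [d] already secures the value [m], or the block of
    [i0] is still to come and will secure it. *)
Lemma run_indeg_ge (R : realFieldType) n k (G : digraph n)
    (a : {ffun 'I_n -> 'I_k}) (i0 : 'I_n) js c d m :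
    (if c is Some v then (d <= indeg G setT v)%N else d == 0%N) ->
    (m <= d)%N \/
    (a i0 : nat) \in js /\ (m <= indeg G (before a (a i0)) i0)%N ->
  m%:R <= \sum_i run R G a js c d i * (indeg G setT i)%:R.
Proof.
elim: js c d m => [|j js IH] c d m /= dc.
  case=> [md|[]//]; case: c dc => [v|] dc.
    rewrite (bigD1 v) //= eqxx mul1r big1 ?addr0 ?ler_nat ?(leq_trans md) //.
    move=> i iv; rewrite (_ : (Some v == Some i) = (v == i)) //.
    by rewrite eq_sym (negbTE iv) mul0r.
  (* With no candidate the run returns no vertex and the sum is 0, but then [d = 0] forces
     [m = 0]. *)
  move: md; rewrite (eqP dc) leqn0 => /eqP->.
  by apply: sumr_ge0 => i _; rewrite mul0r.
move=> hm; set test := (block a j != set0) && _.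
have [/andP[ne dmax]|keep] := boolP test; last first.
  apply: IH dc _; case: hm => [md|[]]; first by left.
  rewrite inE; case/orP=> [/eqP i0j mi0|]; last by right.
  have i0B : i0 \in block a j by rewrite inE i0j.
  left; move: keep; rewrite /test (_ : block a j != set0); last first.
    by apply/set0Pn; exists i0.
  rewrite -ltnNge => lt_d; apply: leq_trans mi0 _; rewrite i0j.
  apply: leq_trans (indeg_del_candidate _ _ c _) (leq_ltn_trans _ lt_d).
  exact: leq_bigmax_cond.
set A := argmax_set _ _; have A0 : (0 < #|A|)%N by exact: argmax_set_gt0.
under eq_bigr do rewrite mulr_suml.
rewrite exchange_big /=; under eq_bigr do under eq_bigr do rewrite -mulrA.
under eq_bigr do rewrite -mulr_sumr.
(* Writing [m] as an average over [A] reduces the claim to each new candidate [c'] separately. *)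
have {1}-> : m%:R = \sum_(c' in A) #|A|%:R^-1 * m%:R :> R.
  rewrite sumr_const -[RHS]mulr_natl mulrA mulfV ?mul1r //.
  by rewrite pnatr_eq0 -lt0n.
apply: ler_sum => c'; rewrite inE => /andP[c'B /forall_inP c'max].
apply: ler_wpM2l; first by rewrite invr_ge0 ler0n.
apply: IH; first exact/leq_indeg/subsetT.
case: hm => [md|[]].
  (* [d] does not decrease: the test ignores arcs from the old candidate, whereas [c'] maximizes the
     indegree with these arcs included. *)
  left; apply: leq_trans md (leq_trans dmax _).
  apply/bigmax_leqP => v vB; apply: leq_trans (c'max v vB).
  exact/leq_indeg/subsetDl.
rewrite inE => /orP[/eqP i0j mi0|]; last by right.
left; apply: leq_trans mi0 _; rewrite i0j; apply: c'max.
by rewrite inE i0j.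
Qed.

Lemma kpart_given_indeg_ge (R : realFieldType) k (init : initial_choice R k) n
    (G : digraph n.+1) (a : {ffun 'I_n.+1 -> 'I_k}) i0 :
  (indeg G (before a (a i0)) i0)%:R
    <= \sum_i kpart_given init G a i * (indeg G setT i)%:R.
Proof.
have bnd c : (indeg G (before a (a i0)) i0)%:R
    <= \sum_i run R G a (iota 1 k.-1) c 0 i * (indeg G setT i)%:R.
  apply: (@run_indeg_ge _ _ _ _ _ i0); first by case: c.
  have [a0|a_gt0] := posnP (a i0).
    (* The first block is never processed by the loop, but no block precedes it, so the value to
       secure is 0. *)
    left; rewrite a0 (_ : before a 0 = set0); first by rewrite indeg_set0.
    by apply/setP => v; rewrite !inE.
  right; split=> //; rewrite mem_iota a_gt0 add1n prednK ?ltn_ord //.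
  exact: leq_ltn_trans (ltn_ord (a i0)).
rewrite /kpart_given; have [_|_] := boolP (block a 0 == set0); first exact: bnd.
under eq_bigr do rewrite mulr_suml.
rewrite exchange_big /=; under eq_bigr do under eq_bigr do rewrite -mulrA.
under eq_bigr do rewrite -mulr_sumr.
rewrite -[leLHS]mul1r -[X in X * _ <= _](prob_sum1 (init n G a)) mulr_suml.
apply: ler_sum => c _; apply: ler_wpM2l; first exact: prob_ge0.
exact: bnd.
Qed.

(** The blocks of two distinct vertices are jointly uniform. By linearity it suffices to treat
    indicators of [a u = x] and [a v = y]; these factor over the vertices, so the sum over all [a]
    becomes a product of sums. *)
Lemma sum_uniform_pair (R : realFieldType) (T : finType) k (u v : T)
    (f : 'I_k -> 'I_k -> R) : (0 < k)%N -> u != v ->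
  \sum_(a : {ffun T -> 'I_k}) (\prod_(w : T) k%:R^-1) * f (a u) (a v)
    = k%:R^-2 * \sum_x \sum_y f x y.
Proof.
move=> k0 uv; have vu : v != u by rewrite eq_sym.
pose K : R := k%:R^-1.
have kK : \sum_(z < k) K = 1.
  by rewrite sumr_const card_ord -[_ *+ _]mulr_natl mulfV // pnatr_eq0 -lt0n.
pose g (x y : 'I_k) w (z : 'I_k) : R :=
  K * ((w == u) ==> (z == x))%:R * ((w == v) ==> (z == y))%:R.
have sum_delta (x : 'I_k) (F : 'I_k -> R) : \sum_z (z == x)%:R * F z = F x.
  rewrite (bigD1 x) //= eqxx mul1r big1 ?addr0 // => z /negbTE->.
  by rewrite mul0r.
have prod_g x y (a : {ffun T -> 'I_k}) :
    \prod_w g x y w (a w) = (\prod_(w : T) K) * ((a u == x) && (a v == y))%:R.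
  rewrite !big_split /= -mulrA; congr (_ * _).
  rewrite (bigD1 u) //= [X in _ * X](bigD1 v) //= !eqxx /=.
  rewrite !big1 ?mulr1 => [|w /negbTE->|w /negbTE->] //.
  by rewrite -natrM mulnb.
(* The constrained vertices [u] and [v] contribute [K] each, every other vertex its total mass 1. *)
have sum_g x y : \prod_w \sum_z g x y w z = K ^+ 2.
  rewrite (bigD1 u) // (bigD1 v) //= [X in _ * (_ * X)]big1 => [|w]; last first.
    case/andP=> /negbTE wu /negbTE wv.
    by rewrite -[RHS]kK; apply: eq_bigr => z _; rewrite /g wu wv !mulr1.
  rewrite mulr1 expr2 /g !eqxx (negbTE uv) (negbTE vu) /=.
  congr (_ * _); [rewrite -[RHS](sum_delta x (fun=> K))
    | rewrite -[RHS](sum_delta y (fun=> K))];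
    by apply: eq_bigr => z _; rewrite !mulr1 mulrC.
have f_delta x0 y0 : f x0 y0 =
    \sum_x \sum_y ((x0 == x) && (y0 == y))%:R * f x y.
  rewrite -(sum_delta x0 (f^~ y0)); apply: eq_bigr => x _.
  rewrite -(sum_delta y0 (f x)) mulr_sumr; apply: eq_bigr => y _.
  by rewrite mulrA -natrM mulnb ![_ == x0]eq_sym ![_ == y0]eq_sym.
under [LHS]eq_bigr => a _ do rewrite f_delta mulr_sumr.
rewrite exchange_big mulr_sumr; apply: eq_bigr => x _ /=.
under [LHS]eq_bigr => a _ do rewrite mulr_sumr.
rewrite exchange_big mulr_sumr; apply: eq_bigr => y _ /=.
under [LHS]eq_bigr => a _ do rewrite mulrA -prod_g.
by rewrite -mulr_suml -bigA_distr_bigA sum_g exprVn.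
Qed.

(** Each [y] has exactly [y] smaller indices, and these counts add up to the binomial
    coefficient. *)
Lemma sum_ltn_ord (R : pzSemiRingType) k :
  \sum_(x < k) \sum_(y < k) (x < y)%:R = 'C(k, 2)%:R :> R.
Proof.
rewrite exchange_big -bin2_sum big_mkord natr_sum; apply: eq_bigr => y _.
rewrite -natr_sum -[in RHS](card_ord y) -sum1_card.
rewrite (big_ord_widen k (fun=> 1%N)) 1?ltnW // [in RHS]big_mkcond /=.
by congr _%:R; apply: eq_bigr => x _; case: ltnP.
Qed.

(** By linearity of expectation, each in-neighbour of [i0] counts with probability
    ['C(k, 2) / k^2]. *)
Lemma expect_indeg_before (R : realFieldType) n k (G : digraph n) (i0 : 'I_n) :
    (0 < k)%N ->
  \sum_(a : {ffun 'I_n -> 'I_k})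
      (\prod_(v < n) k%:R^-1) * (indeg G (before a (a i0)) i0)%:R
    = (k%:R - 1) / (2 * k%:R) * (indeg G setT i0)%:R :> R.
Proof.
move=> k0; have k_neq0 : k%:R != 0 :> R by rewrite pnatr_eq0 -lt0n.
have indegE S : (indeg G S i0)%:R =
    \sum_(v | (v, i0) \in arcs G) (v \in S)%:R :> R.
  rewrite /indeg -sum1_card natr_sum big_mkcond [RHS]big_mkcond.
  by apply: eq_bigr => v _; rewrite inE; case: (v \in S); case: ifP.
under eq_bigr do rewrite indegE mulr_sumr.
rewrite exchange_big indegE mulr_sumr; apply: eq_bigr => v vi0 /=.
(* Absence of loops makes the blocks of [v] and [i0] independent. *)
have v_neq : v != i0 by apply: contraTneq vi0 => ->; exact: no_loops.
under eq_bigr do rewrite inE.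
rewrite (sum_uniform_pair _ _ _ _ _ (fun x y : 'I_k => (x < y)%:R)) //.
rewrite sum_ltn_ord.
have : (2 * 'C(k, 2))%:R = k%:R * (k%:R - 1) :> R.
  by rewrite -mul_bin_diag bin1 natrM -[in k%:R - 1](prednK k0) -natr1 addrK.
rewrite inE mulr1 natrM => C2; have two0 : 2 != 0 :> R by rewrite pnatr_eq0.
by apply: (mulfI two0); rewrite mulrCA C2; field; rewrite k_neq0.
Qed.

Theorem theorem3 (R : realFieldType) (k : nat) (hk : (2 <= k)%N)
    (init : initial_choice R k) :
  optimal ((k%:R - 1) / (2 * k%:R)) (kpartition hk init).
Proof.
move=> n G _; have [|i0 max_i0] := @bigop.eq_bigmax 'I_n.+1 (indeg G setT).
  by rewrite card_ord.
rewrite /max_indeg max_i0.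
rewrite -expect_indeg_before 1?ltnW //= /kpart_prob.
under [leRHS]eq_bigr do rewrite mulr_suml.
(* The two expectations are compared partition by partition. *)
rewrite exchange_big /=; apply: ler_sum => a _.
under [leRHS]eq_bigr do rewrite -mulrA.
rewrite -mulr_sumr; apply: ler_wpM2l; last exact: kpart_given_indeg_ge.
by apply: prodr_ge0 => v _; rewrite invr_ge0 ler0n.
Qed.
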